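(* For every fixed integer $k\ge0$, the nonzero sequence $(B_{k,0,r})_r$ is log-concave, i.e. $B_{k,0,r}^2\ge B_{k,0,r-1}B_{k,0,r+1}$ for all $r$.
   Context: For integers $k,d\ge0$ let $c_k(2,d)\in\mathbb{Z}[x_1,x_2]$ be the homogeneous degree-$k$ part of $\prod_{i=0}^d(1+ix_1+(d-i)x_2)$. Expand it in two-variable Schur polynomials: $$c_k(2,d)=\sum_{0\le j\le\lfloor k/2\rfloor}A_{k,j}(d)\,s_{(k-j,j)}(x_1,x_2).$$ For fixed $k,j$, $A_{k,j}(d)$ is a polynomial function of $d$, and the numbers $B_{k,j,r}$ $(r\ge0)$ are its coefficients in the binomial basis: $A_{k,j}(d)=\sum_{r\ge0}B_{k,j,r}\binom dr$; put $B_{k,j,r}=0$ for $r<0$. *)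

(* Defs.v *)
From HB Require Import structures.
From mathcomp Require Import all_boot all_order all_algebra.
From mathcomp Require Export mpoly.

Set Implicit Arguments.
Unset Strict Implicit.
Unset Printing Implicit Defensive.

Import Order.TTheory GRing.Theory Num.Theory.

Local Open Scope ring_scope.

(* Cells (row, column) of the Young diagram of la, both counted from 0. *)
Definition cell (la : seq nat) : finType :=
  {i : 'I_(size la) & 'I_(nth 0%N la i)}.

Definition semistandard (n : nat) (la : seq nat)
    (T : {ffun cell la -> 'I_n}) : bool :=
  [forall c : cell la, forall c' : cell la,
      ((tag c == tag c') && (tagged c <= tagged c')%N ==> (T c <= T c')%N)
   && ((tag c < tag c')%N && (tagged c == tagged c' :> nat)
         ==> (T c < T c')%N)].

(* The Schur polynomial s_la(x_0, ..., x_(n-1)), as the generating polynomial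
   of semistandard tableaux; la is meant to be a partition, possibly with
   trailing zero parts. *)
Definition schur (n : nat) (la : seq nat) : {mpoly int[n]} :=
  \sum_(T : {ffun cell la -> 'I_n} | semistandard T) \prod_(c : cell la) 'X_(T c).

(* The variables x_1, x_2 are indexed by 0, 1 : 'I_2. *)
Definition total_class (d : nat) : {mpoly int[2]} :=
  \prod_(i < d.+1) (1 + 'X_(0 : 'I_2) *+ i + 'X_(1 : 'I_2) *+ (d - i)).

Definition chern (k d : nat) : {mpoly int[2]} :=
  pihomog mdeg k (total_class d).

(* The coefficients A k j d are those of c_k(2, d) in the Schur polynomials
   (linearly independent, so this determines A k j d for j <= k./2). *)
Definition schur_coefficients (A : nat -> nat -> nat -> int) : Prop :=
  forall k d : nat,
    chern k d = \sum_(j < (k./2).+1) A k j d *: schur 2 [:: (k - j)%N; j : nat].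

(* f is a polynomial function on nat whose coefficients in the binomial basis
   are the b r, with b extended by 0 to negative indices; f determines b. *)
Definition binomial_coefficients (f : nat -> int) (b : int -> int) : Prop :=
  (forall r : int, r < 0 -> b r = 0) /\
  exists N : nat,
    (forall r : nat, (N <= r)%N -> b r%:Z = 0) /\
    (forall d : nat, f d = \sum_(r < N) b r%:Z * ('C(d, r))%:Z).

Definition log_concave (b : int -> int) : Prop :=
  forall r : int, b (r - 1) * b (r + 1) <= b r ^+ 2.

(* Main.v *)
(* Setting x_2 = 0 kills every s_(k-j,j) with j > 0, so A_{k,0}(d) is the
   coefficient of X^k in the product of the 1 + i X, i <= d.  Its recurrence
   A_{k+1,0}(d+1) - A_{k+1,0}(d) = (d+1) A_{k,0}(d), read in the binomial basis
   through (r+1) C(d,r+1) = (d-r) C(d,r), becomes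
   B_{k+1,r+1} = (r+1) B_{k,r} + r B_{k,r-1}.
   Hence B_{k,r} is a natural number with support k <= r <= 2k, and
   log-concavity propagates along the recurrence: with a, b, c, e consecutive
   values of B_k, it follows from a c <= b^2, b e <= c^2 and a e <= b c, the last
   one holding because the support has no gaps. *)
Require Import Defs.
From mathcomp Require Import all_boot all_order all_algebra.
From mathcomp Require Import zify.

Set Implicit Arguments.
Unset Strict Implicit.
Unset Printing Implicit Defensive.

Import GRing.Theory Num.Theory.

(* At r' = 0 the junk value r'.-1 = 0 is harmless: its factor r' vanishes. *)
Fixpoint binom_coef (k r : nat) : nat :=
  match k, r with
  | 0, _ => r == 0
  | k'.+1, 0 => 0
  | k'.+1, r'.+1 => r'.+1 * binom_coef k' r' + r' * binom_coef k' r'.-1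
  end.

Arguments binom_coef : simpl never.

Lemma binom_coefS0 k : binom_coef k.+1 0 = 0.
Proof. by []. Qed.

Lemma binom_coefSS k r :
  binom_coef k.+1 r.+1 =
    r.+1 * binom_coef k r + r * binom_coef k r.-1.
Proof. by []. Qed.

Lemma binom_coef_gt0 k r : (0 < binom_coef k r) = (k <= r <= k.*2).
Proof.
elim: k r => [|k IH] [|r] //.
rewrite binom_coefSS addn_gt0 !muln_gt0 !IH.
by case: r => [|r]; rewrite /=; lia.
Qed.

Lemma binom_coef_log_concave k r :
  binom_coef k r * binom_coef k r.+2 <= binom_coef k r.+1 ^ 2.
Proof.
elim: k r => [|k IH] [|r] //; rewrite -mulnn ?binom_coefS0 ?binom_coefSS.
case: r => [|r].
  by have := IH 0; rewrite -mulnn /=; nia.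
have := IH r; have := IH r.+1; rewrite -!mulnn /=.
(* If the right side is 0, an inner index lies outside the support interval, hence so does an outer
   one. Otherwise the two induction hypotheses are multiplied and the positive right side is
   cancelled. *)
have: binom_coef k r * binom_coef k r.+3 <=
      binom_coef k r.+1 * binom_coef k r.+2.
  have [bc0|bc_gt0] := posnP (binom_coef k r.+1 * binom_coef k r.+2).
    rewrite bc0 leqNgt muln_gt0 !binom_coef_gt0.
    by move/eqP: bc0; rewrite -leqn0 leqNgt muln_gt0 !binom_coef_gt0; lia.
  rewrite -(leq_pmul2l bc_gt0).
  by have := leq_mul (IH r) (IH r.+1); rewrite -!mulnn; lia.
move: (binom_coef k r) (binom_coef k r.+1) => a b.
move: (binom_coef k r.+2) (binom_coef k r.+3) => c e.
(* The factors are the coefficients of [a * e], [b * e] and [a * c] in the expanded product. They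
   suffice since (r+4)(r+2) < (r+3)^2, (r+3)(r+1) < (r+2)^2 and (r+4)(r+1) < (r+3)(r+2). *)
move=> /(leq_mul (leqnn (r.+4 * r.+1))) h1.
move=> /(leq_mul (leqnn (r.+4 * r.+2))) h2.
move=> /(leq_mul (leqnn (r.+3 * r.+1))) h3.
lia.
Qed.

Local Open Scope ring_scope.

Definition rising_poly (d : nat) : {poly int} := \prod_(i < d.+1) (1 + 'X *+ i).

Lemma rising_poly0 : rising_poly 0 = 1.
Proof. by rewrite /rising_poly big_ord1 mulr0n addr0. Qed.

Lemma rising_polyS d :
  rising_poly d.+1 = rising_poly d + rising_poly d * 'X *+ d.+1.
Proof. by rewrite /rising_poly big_ord_recr /= mulrDr mulr1 mulrnAr. Qed.

(** Split d+1 = (r+1) + (d-r): the second part, absorbed into C(d,r+1) and shifted by one index,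
    yields the second term of the recurrence. *)
Lemma binom_coef_sum k d :
  (d.+1 * \sum_(r < d.+1) binom_coef k r * 'C(d, r) =
   \sum_(r < d.+1) binom_coef k.+1 r.+1 * 'C(d, r))%N.
Proof.
under [RHS]eq_bigr do rewrite binom_coefSS mulnDl.
rewrite big_split /= [X in _ = (_ + X)%N]big_ord_recl /= add0n.
have -> : (\sum_(i < d) bump 0 i * binom_coef k i * 'C(d, bump 0 i) =
  \sum_(i < d.+1) (d - i) * (binom_coef k i * 'C(d, i)))%N.
  (* The extra top term i = d has factor d - d = 0. *)
  rewrite big_ord_recr /= subnn mul0n addn0; apply: eq_bigr => i _.
  by rewrite /bump /= add1n mulnAC mul_bin_left; lia.
rewrite -big_split big_distrr /=; apply: eq_bigr => i _.
by rewrite -mulnA -mulnDl addSn subnKC // -ltnS.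
Qed.

Lemma coef_rising_poly k d :
  (rising_poly d)`_k = (\sum_(r < d.+1) binom_coef k r * 'C(d, r))%N%:Z.
Proof.
elim: k d => [|k IHk] d.
  rewrite big_ord_recl big1 //= bin0.
  elim: d => [|d IH]; first by rewrite rising_poly0 coef1.
  by rewrite rising_polyS coefD coefMn coefMX IH mul0rn.
elim: d => [|d IHd]; first by rewrite rising_poly0 coef1 big_ord1.
rewrite rising_polyS coefD coefMn coefMX /= IHd IHk.
rewrite -mulr_natl natz -!PoszM -!PoszD.
congr Posz; rewrite binom_coef_sum.
rewrite [in RHS]big_ord_recl /= binom_coefS0 mul0n add0n.
(* Pascal's rule: the C(d,r) part is the sum from [binom_coef_sum], and the C(d,r+1) part is the sum
   for d up to vanishing end terms. *)
under [in RHS]eq_bigr do rewrite /bump leq0n add1n binS mulnDr.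
rewrite big_split; congr addn.
rewrite big_ord_recl big_ord_recr /= binom_coefS0 (bin_small (ltnSn d)).
rewrite muln0 mul0n add0n addn0.
by under eq_bigr do rewrite /bump leq0n add1n.
Qed.

(** The system is triangular with diagonal entries C(r,r) = 1. *)
Lemma binomial_basis_inj (b c : nat -> int) :
  (forall d, \sum_(r < d.+1) b r * 'C(d, r)%:Z =
             \sum_(r < d.+1) c r * 'C(d, r)%:Z) ->
  b =1 c.
Proof.
move=> bc r; elim/ltn_ind: r => r IH; have := bc r.
rewrite !big_ord_recr /= binn !mulr1 => /eqP; rewrite -subr_eq0 => /eqP.
under eq_bigr => i _ do rewrite IH //.
by rewrite opprD addrACA subrr add0r => /eqP; rewrite subr_eq0 => /eqP.
Qed.

(** The bounds N and d+1 are interchangeable: [b] vanishes from N on, C(d,r) for r > d. *)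
Lemma binomial_coefficients_sum f b d : binomial_coefficients f b ->
  f d = \sum_(r < d.+1) b r%:Z * 'C(d, r)%:Z.
Proof.
case=> _ [N [bN ->]].
pose F r := b r%:Z * 'C(d, r)%:Z.
have [leNd|ltdN] := leqP N d.+1.
  rewrite (big_ord_widen _ F leNd) big_mkcond /=; apply: eq_bigr => r _.
  by case: ltnP => // /bN ->; rewrite mul0r.
rewrite [RHS](big_ord_widen _ F (ltnW ltdN)) [RHS]big_mkcond /=.
by apply: eq_bigr => r _; case: ltnP => // ltdr; rewrite bin_small ?mulr0.
Qed.

Notation eval_x0 :=
  (mmap (@polyC int) (fun i : 'I_2 => if i == 0 then 'X else 0)).

Lemma eval_x0_total_class d : eval_x0 (total_class d) = rising_poly d.
Proof.
rewrite rmorph_prod; apply: eq_bigr => i _.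
by rewrite !rmorphD rmorph1 !rmorphMn /= !mmapX !mmap1U /= mul0rn addr0.
Qed.

(** Only pure powers of x_1 survive, and for these the total degree is the exponent of X. *)
Lemma eval_x0_chern k d : eval_x0 (chern k d) = (rising_poly d)`_k *: 'X^k.
Proof.
rewrite -eval_x0_total_class /chern.
move: (total_class d) => p; rewrite [p in RHS]mpolyE pihomogE big_mkcond /=.
rewrite !raddf_sum coef_sum scaler_suml; apply: eq_bigr => m _.
have m1 : lift ord0 ord0 = 1 :> 'I_2 by apply: val_inj.
have lineX : eval_x0 'X_[m] = 'X^(m 0) *+ (m 1 == 0%N).
  rewrite mmapX /mmap1 big_ord_recl big_ord1 m1 /= expr0n.
  by case: (m 1 == 0%N); rewrite ?mulr1 ?mulr0.
have degm : mdeg m = (m 0%R + m 1%R)%N.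
  by rewrite mdegE big_ord_recl big_ord1 m1.
rewrite degm /= [eval_x0 (if _ then _ else _)]fun_if raddf0 !mmapZ lineX.
have [->|_] := eqVneq (m 1) 0%N; last first.
  by rewrite mulr0 coef0 scale0r; case: ifP.
rewrite addn0 coefCM coefXn mulr_natr mulrb -mul_polyC eq_sym.
by case: eqVneq => [->|]; rewrite ?mul0r.
Qed.

Lemma eval_x0_schur a b : (b <= a)%N ->
  eval_x0 (schur 2 [:: a; b]) = if b == 0%N then 'X^a else 0.
Proof.
move=> leba; rewrite raddf_sum /=.
have eval_tab (T : {ffun cell [:: a; b] -> 'I_2}) c :
    T c != 0 -> eval_x0 (\prod_c 'X_(T c)) = 0.
  move=> Tc; rewrite rmorph_prod (bigD1 c) //= mmapX mmap1U (negbTE Tc).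
  by rewrite mul0r.
case: b leba eval_tab => [|b] leba eval_tab /=.
  (* For a single row, only the tableau filled with 0 survives. *)
  rewrite (bigD1 [ffun=> 0]) /=; last first.
    apply/forallP => c; apply/forallP => c'; rewrite !ffunE leqnn implybT.
    by case: c' => [[[|[|j]] ltj] [y lty]]; rewrite /= ?ltn0.
  rewrite [X in _ + X]big1 => [|T /andP[_ neT]]; last first.
    have [c Tc] : exists c, T c != 0.
      apply/existsP; apply: contra_neqT neT => /existsPn T0.
      by apply/ffunP => c; rewrite ffunE; apply/eqP/negPn/T0.
    exact: eval_tab Tc.
  rewrite addr0 rmorph_prod /=.
  under eq_bigr do rewrite ffunE mmapX mmap1U /=.
  rewrite prodr_const card_tagged sumnE big_map big_enum /=.
  by rewrite big_ord_recl big_ord1 !card_ord addn0.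
apply: big1 => T /'forall_forallP ssT.
(* The first column has two cells [c] and [c']; strict increase forces a nonzero entry in the lower
   one. *)
pose row (i : 'I_2) := 'I_(nth 0%N [:: a; b.+1] i).
pose c : cell [:: a; b.+1] :=
  @Tagged _ ord0 row (Ordinal (leq_trans (ltn0Sn b) leba)).
pose c' : cell [:: a; b.+1] := @Tagged _ ord_max row (@Ordinal b.+1 0 isT).
apply: (eval_tab T c').
have /andP[_] := ssT c c'.
by rewrite /=; case: (T c') => [[|]].
Qed.

Lemma schur_coefficients0 A k d : schur_coefficients A ->
  A k 0%N d = (rising_poly d)`_k.
Proof.
move=> hA; have := congr1 (fun p => (eval_x0 p)`_k) (hA k d).
rewrite eval_x0_chern coefZ coefXn eqxx mulr1 => ->.
rewrite raddf_sum big_ord_recl big1 => [|j _] /=.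
  by rewrite addr0 mmapZ eval_x0_schur // subn0 coefCM coefXn eqxx mulr1.
rewrite mmapZ eval_x0_schur ?mulr0 // /bump leq0n add1n.
have := ltn_ord j; lia.
Qed.

Theorem theorem3p7
    (A : nat -> nat -> nat -> int) (hA : schur_coefficients A)
    (B : nat -> nat -> int -> int)
    (hB : forall k j : nat, (j <= k./2)%N ->
            binomial_coefficients (A k j) (B k j))
    (k : nat) :
  (exists r : int, B k 0%N r <> 0%R) /\ log_concave (B k 0%N).
Proof.
have hBk := hB k 0%N (leq0n _).
have Bneg r : r < 0 -> B k 0%N r = 0 by case: hBk => + _; apply.
have BE : (fun r : nat => B k 0%N r%:Z) =1 (fun r => (binom_coef k r)%:Z).
  apply: binomial_basis_inj => d.
  rewrite -(binomial_coefficients_sum d hBk) (schur_coefficients0 k d hA).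
  rewrite coef_rising_poly -natz natr_sum.
  by apply: eq_bigr => r _; rewrite natz PoszM.
split.
  (* k is the left end of the support. *)
  exists k%:Z; rewrite BE => -[] /eqP; apply/negP.
  by rewrite -lt0n binom_coef_gt0 -addnn leqnn leq_addr.
case=> [[|r]|r].
- by rewrite sub0r Bneg // mul0r sqr_ge0.
- have -> : Posz r.+1 - 1 = r by lia.
  have -> : Posz r.+1 + 1 = r.+2 by lia.
  rewrite !BE; have := binom_coef_log_concave k r; rewrite -mulnn expr2; lia.
- by rewrite Bneg ?mul0r ?sqr_ge0 //; lia.
Qed.
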